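(* Let $i\in[N_U]=\{1,\dots,N_U\}$, let $\lambda_i>0$, $\mu>0$, $\varphi_i\in(0,1]$, and let $h_i\ge 0$ be a random variable with cumulative distribution function $F_{h_i}$. Set $$\kappa_i=\frac{\lambda_i\varphi_i}{\mu\sigma_i^2},\qquad C_{z}=\frac{\sigma_i^2\kappa_i h_i^2}{\sigma_i^2+z h_i^2},\qquad \bar H(z)=\sqrt{\frac{\sigma_i^2}{\sigma_i^2\kappa_i-z}},\qquad \bar{\mathcal H}(z)=[0,\bar H(z)],$$ where $\bar H(\sigma_i^2\kappa_i)$ is read as $+\infty$, so that $\bar{\mathcal H}(\sigma_i^2\kappa_i)=[0,\infty)$ and $F_{h_i}(\bar H(\sigma_i^2\kappa_i))=1$. Consider the problem $$\sup_{z_i\in\mathbb{R}}\left\{-\mu z_i+\mathbb{E}\left[\lambda_i\log\left(1+\frac{p_i^*\cdot h_i^2}{\sigma_i^2}\right)-\frac{\mu}{\varphi_i}(p_i^*-z_i)_+\right]\right\},$$ where $$p_i^*=\max\left\{\left(\frac{\lambda_i\varphi_i}{\mu}-\frac{\sigma_i^2}{h_i^2}\right)_+,\ (z_i)_+\right\}.$$ The optimal solution $z_i^*$ of this problem satisfies the inclusions (cases read in order) $$z_i^*\in\begin{cases}\{0\}, & 1-\varphi_i\le \mathbb{E}\left[(1-\kappa_i h_i^2)\cdot\mathbf{1}_{\bar{\mathcal H}(0)}(h_i)\right],\\ (0,\sigma_i^2\kappa_i], & 1-\varphi_i\le \mathbb{E}\left[(1-C_{\sigma_i^2\kappa_i})\cdot\mathbf{1}_{\bar{\mathcal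 H}(\sigma_i^2\kappa_i)}(h_i)\right],\\ (\sigma_i^2\kappa_i,\infty), & 1-\varphi_i> \mathbb{E}\left[(1-C_{\sigma_i^2\kappa_i})\cdot\mathbf{1}_{\bar{\mathcal H}(\sigma_i^2\kappa_i)}(h_i)\right].\end{cases}$$ Moreover, the optimal solution $z_i^*$ satisfies $$\mathbb{E}\left[C_{z_i^*}\cdot\mathbf{1}_{\bar{\mathcal H}(z_i^* )}(h_i)\right]+1-F_{h_i}\left(\bar H(z_i^* )\right)=\varphi_i,\quad z_i^*\in(0,\sigma_i^2\kappa_i],$$ $$\mathbb{E}\left[C_{z_i^*}\right]=\varphi_i,\quad z_i^*\in[\sigma_i^2\kappa_i,\infty).$$
   Context: Notation: $(x)_+=\max\{x,0\}$, $\mathbf{1}_A$ is the indicator function of the set $A$, and expectations are with respect to the distribution of $h_i$. There are $N_U$ terminals in a parallel, interference-free point-to-point communication network. For terminal $i$: $h_i$ is the random fading coefficient, $\sigma_i^2$ is the noise variance of the link, $\log(1+p_i h_i^2/\sigma_i^2)$ is the instantaneous rate under power $p_i$, $\varphi_i$ is the confidence level of the Conditional Value-at-Risk $\mathrm{CVaR}^{\varphi_i}[\xi]=\inf_{z\in\mathbb{R}}\{z+\frac{1}{\varphi_i}\mathbb{E}[(\xi-z)_+]\}$ imposed on the power, and $z_i$ is the corresponding CVaR auxiliary variable. The numbers $\lambda_i$ and $\mu$ are Lagrange multipliers (of the rate constraint of terminal $i$ and of the total power constraint, respectively). The quantity $p_i^*$, which depends on $h_i$ and $z_i$, is the optimal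 power policy, i.e. a maximizer over $p_i\ge 0$ of $\lambda_i\log(1+p_i h_i^2/\sigma_i^2)-\frac{\mu}{\varphi_i}(p_i-z_i)_+$.
   Formalization: The integrand of the objective is assumed integrable for each z. Optimal solutions need not be unique, so the inclusions are proved for some optimal solution in general, and for every one when φ_i<1 and P(h_i>0)≠φ_i. *)

(* Defs.v *)
From mathcomp Require Import all_boot all_order all_algebra.
From mathcomp Require Import all_classical all_reals all_analysis.

Set Implicit Arguments.
Unset Strict Implicit.
Unset Printing Implicit Defensive.

Import Order.TTheory GRing.Theory Num.Theory.
Import numFieldNormedType.Exports.

Local Open Scope classical_set_scope.
Local Open Scope ring_scope.

(* [sigma] is the standard deviation of the noise: the noise variance is
   [sigma ^+ 2].  Logarithms are natural. *)

Definition posp {R : realType} (x : R) : R := Num.max x 0.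

Section SingleTerminal.
Context {R : realType}.
Variables (lambda mu phi sigma : R).

Definition rate (p h : R) : R := ln (1 + p * h ^+ 2 / sigma ^+ 2).

(* For [h = 0] the quotient [sigma ^+ 2 / h ^+ 2] stands for +oo, so that the
   positive part vanishes; Rocq's convention [x / 0 = 0] would give
   [lambda * phi / mu] instead. *)
Definition waterfill (h : R) : R :=
  if h == 0 then 0 else posp (lambda * phi / mu - sigma ^+ 2 / h ^+ 2).

Definition opt_power (z h : R) : R := Num.max (waterfill h) (posp z).

Definition payoff (z h : R) : R :=
  lambda * rate (opt_power z h) h - mu / phi * posp (opt_power z h - z).

Definition kappa : R := lambda * phi / (mu * sigma ^+ 2).

Definition Cfun (z h : R) : R :=
  sigma ^+ 2 * kappa * h ^+ 2 / (sigma ^+ 2 + z * h ^+ 2).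

(* Meaningful for [z <= sigma ^+ 2 * kappa] only. *)
Definition Hbar (z : R) : \bar R :=
  if z == sigma ^+ 2 * kappa then +oo%E
  else (Num.sqrt (sigma ^+ 2 / (sigma ^+ 2 * kappa - z)))%:E.

Definition calH (z : R) : set R := [set x | 0 <= x /\ (x%:E <= Hbar z)%E].

End SingleTerminal.

Section RandomFading.
Context {d : measure_display} {T : measurableType d} {R : realType}.
Context {P : probability T R}.
Variables (lambda mu phi sigma : R) (h : {RV P >-> R}).

Local Open Scope ereal_scope.

Definition objective (z : R) : \bar R :=
  (- mu * z)%:E + 'E_P[fun w => payoff lambda mu phi sigma z (h w)].

Definition optimal_solution (zs : R) : Prop :=
  forall z : R, objective z <= objective zs.

Definition ext_cdf (x : \bar R) : \bar R :=
  match x with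
  | r%:E => cdf h r
  | +oo => 1
  | -oo => 0
  end.

Definition threshold0 : \bar R :=
  'E_P[fun w => ((1 - kappa lambda mu phi sigma * h w ^+ 2)
                 * \1_(calH lambda mu phi sigma 0) (h w))%R].

Definition threshold1 : \bar R :=
  let a := (sigma ^+ 2 * kappa lambda mu phi sigma)%R in
  'E_P[fun w => ((1 - Cfun lambda mu phi sigma a (h w))
                 * \1_(calH lambda mu phi sigma a) (h w))%R].

Definition inclusion_set : set R :=
  let a := (sigma ^+ 2 * kappa lambda mu phi sigma)%R in
  if (1 - phi)%:E <= threshold0 then [set 0%R]
  else if (1 - phi)%:E <= threshold1 then `]0%R, a]%classic
  else `]a, +oo[%classic.

End RandomFading.

(* Main.v *)
(* Write a = lambda phi / mu and q_z for the optimal power.  For z >= 0 the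
   payoff is concave in z with derivative mu / phi times
   m_z = a h^2 / (sigma^2 + q_z h^2) = min(1, C_z), and for z <= 0 it is affine
   with slope mu / phi.  Instead of differentiating under the expectation, the
   payoff increments over [y, z] are bounded by m_z and m_y times the length, by
   concavity of ln, and these bounds pass to the mean M(z) = E[m_z].  Moreover M
   is nonincreasing, (1 / a)-Lipschitz and at most a / z, so a positive z is
   optimal exactly when M(z) = phi, and 0 is optimal exactly when M(0) <= phi;
   the two thresholds are 1 - M(0) and 1 - M(a).  If M takes the value phi at two
   points y < z, then m_z = 1 almost surely on {h > 0}, so P(h > 0) = phi, which
   is the degenerate case excluded in the uniqueness of the inclusion. *)

Require Import Defs.
From mathcomp Require Import all_boot all_order all_algebra.
From mathcomp Require Import all_classical all_reals all_analysis.
From mathcomp Require Import measurable_realfun ring lra.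

Import Order.TTheory GRing.Theory Num.Theory.
Import numFieldNormedType.Exports.

Local Open Scope classical_set_scope.
Local Open Scope ring_scope.

(** * Two tools: the tangent bound for [ln] and continuity from a Lipschitz bound *)

Lemma ln_diff_le (R : realType) (x y : R) : 0 < x -> 0 < y ->
  ln y - ln x <= (y - x) / x.
Proof.
move=> x0 y0; rewrite -ln_div ?posrE //.
have -> : y / x = 1 + (y - x) / x by field; rewrite gt_eqF.
apply: le_ln1Dx; have -> : (y - x) / x = y / x - 1 by field; rewrite gt_eqF.
by have := divr_gt0 y0 x0; lra.
Qed.

Lemma lipschitz_cts (R : realType) (f : R -> R) (c : R) : 0 < c ->
  (forall x y, `|f x - f y| <= c * `|x - y|) -> continuous f.
Proof.
move=> c0 fc x; apply/cvgrPdist_lt => e e0; near=> y.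
apply: (le_lt_trans (fc _ _)); rewrite mulrC -ltr_pdivlMr //.
near: y; apply: cvgr_dist_lt => //; exact: divr_gt0.
Unshelve. all: by end_near. Qed.

(** * First-order optimality for an abstract mean payoff [J] with slope function [M] *)

Section FirstOrder.
Context {R : realType} {J M : R -> R} {mu phi a : R}.
Hypotheses (mu_gt0 : 0 < mu) (phi_gt0 : 0 < phi) (a_gt0 : 0 < a)
  (J_increment : forall y z, 0 <= y -> y <= z ->
     mu / phi * ((z - y) * M z) <= J z - J y <= mu / phi * ((z - y) * M y))
  (J_neg : forall z, z <= 0 -> J z = J 0 + mu / phi * z)
  (M_lipschitz : forall y z, y <= z -> 0 <= M y - M z <= (z - y) / a).

Let k_gt0 : 0 < mu / phi. Proof. by rewrite divr_gt0. Qed.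

(** The cost [mu * z] equals [mu / phi * (z * phi)], so the sign of [M - phi] decides whether the
    objective rises or falls. *)
Lemma increment_bounds y z : 0 <= y -> y <= z ->
  mu / phi * ((z - y) * (M z - phi)) <= (J z - mu * z) - (J y - mu * y)
  <= mu / phi * ((z - y) * (M y - phi)).
Proof.
move=> y0 yz; have := J_increment y z y0 yz.
have -> : mu / phi * ((z - y) * (M z - phi)) =
  mu / phi * ((z - y) * M z) - mu * (z - y) by field; rewrite gt_eqF.
have -> : mu / phi * ((z - y) * (M y - phi)) =
  mu / phi * ((z - y) * M y) - mu * (z - y) by field; rewrite gt_eqF.
by rewrite mulrBr; lra.
Qed.

Lemma right_maximizer_le zs : 0 <= zs ->
  (forall z, zs <= z -> J z - mu * z <= J zs - mu * zs) -> M zs <= phi.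
Proof.
move=> zs0 opt; rewrite leNgt; apply/negP => Mgt.
(* The Lipschitz bound loses at most [e / a], half of the gap, so [M (zs + e)] still exceeds [phi]
   and the objective rises strictly. *)
pose e := a * (M zs - phi) / 2.
have e0 : 0 < e by rewrite divr_gt0 // mulr_gt0 // subr_gt0.
have le_e : zs <= zs + e by rewrite lerDl ltW.
have /andP[_] := M_lipschitz _ _ le_e.
have -> : (zs + e - zs) / a = (M zs - phi) / 2.
  by rewrite /e; field; rewrite gt_eqF.
have /andP[+ _] := increment_bounds _ _ zs0 le_e.
rewrite [zs + e - zs]addrAC subrr add0r => inc Me.
have : 0 < mu / phi * (e * (M (zs + e) - phi)).
  by rewrite mulr_gt0 // mulr_gt0 // subr_gt0; lra.
by have := opt _ le_e; lra.
Qed.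

Lemma left_maximizer_ge zs : 0 < zs ->
  (forall z, 0 <= z -> z <= zs -> J z - mu * z <= J zs - mu * zs) ->
  phi <= M zs.
Proof.
move=> zs0 opt; rewrite leNgt; apply/negP => Mlt.
(* The minimum with [zs] keeps [zs - e] nonnegative, where [increment_bounds] applies; the other
   term keeps [M (zs - e)] below [phi]. *)
pose e := Num.min zs (a * (phi - M zs) / 2).
have e0 : 0 < e.
  by rewrite lt_min zs0 /= divr_gt0 // mulr_gt0 // subr_gt0.
have le_e : zs - e <= zs by rewrite gerBl ltW.
have ge_e : 0 <= zs - e by rewrite subr_ge0 ge_min lexx.
have ea : e / a <= (phi - M zs) / 2.
  by rewrite ler_pdivrMr // mulrC mulrA ge_min lexx orbT.
have /andP[_] := M_lipschitz _ _ le_e; rewrite subKr => Me.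
have /andP[_] := increment_bounds _ _ ge_e le_e; rewrite subKr => inc.
have : mu / phi * (e * (M (zs - e) - phi)) < 0.
  by rewrite pmulr_rlt0 // pmulr_rlt0 // subr_lt0; lra.
by have := opt _ ge_e le_e; lra.
Qed.

Lemma neg_increment z : z <= 0 ->
  (J z - mu * z) - (J 0 - mu * 0) = mu / phi * (1 - phi) * z.
Proof. by move=> z0; rewrite J_neg //; field; rewrite gt_eqF. Qed.

(** Right of 0 the upper increment bound is nonpositive; left of 0 the objective is affine with
    slope [mu / phi * (1 - phi) >= 0]. *)
Lemma zero_maximizer : phi <= 1 -> M 0 <= phi ->
  forall z, J z - mu * z <= J 0 - mu * 0.
Proof.
move=> phi1 M0 z; rewrite -subr_le0; have [z0|z0] := leP 0 z.
  have /andP[_ inc] := increment_bounds 0 z (lexx _) z0.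
  apply: (le_trans inc).
  by rewrite pmulr_rle0 // mulr_ge0_le0 ?subr_ge0 // subr_le0.
rewrite (neg_increment _ (ltW z0)) mulr_ge0_le0 ?(ltW z0) //.
by rewrite mulr_ge0 ?subr_ge0 // ltW.
Qed.

(** The increment bound taken at [zs] vanishes on either side, which settles [z >= 0]; a negative
    [z] does no better than 0. *)
Lemma stationary_maximizer zs : phi <= 1 -> 0 <= zs -> M zs = phi ->
  forall z, J z - mu * z <= J zs - mu * zs.
Proof.
move=> phi1 zs0 Mzs.
have nneg z : 0 <= z -> J z - mu * z <= J zs - mu * zs.
  move=> z0; have [zzs|/ltW zzs] := leP z zs.
    have /andP[+ _] := increment_bounds _ _ z0 zzs.
    by rewrite Mzs subrr !mulr0 subr_ge0.
  have /andP[_] := increment_bounds _ _ zs0 zzs.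
  by rewrite Mzs subrr !mulr0 subr_le0.
move=> z; have [|z0] := leP 0 z; first exact: nneg.
apply: le_trans (nneg 0 (lexx _)); rewrite -subr_le0 (neg_increment _ (ltW z0)) //.
rewrite mulr_ge0_le0 ?(ltW z0) //.
by rewrite mulr_ge0 ?subr_ge0 // ltW.
Qed.

(** For [phi < 1] the affine branch left of 0 is strictly increasing; for [phi = 1] it is
    constant. *)
Lemma maximizer_ge0 zs : phi < 1 ->
  (forall z, J z - mu * z <= J zs - mu * zs) -> 0 <= zs.
Proof.
move=> phi1 opt; rewrite leNgt; apply/negP => zs0.
have := opt 0; rewrite -subr_ge0 (neg_increment _ (ltW zs0)) //.
by apply/negP; rewrite -ltNge nmulr_llt0 // mulr_gt0 // subr_gt0.
Qed.

Lemma positive_maximizer zs : 0 < zs ->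
  (forall z, J z - mu * z <= J zs - mu * zs) -> M zs = phi.
Proof.
move=> zs0 opt; apply: le_anti.
by rewrite right_maximizer_le ?left_maximizer_ge // ltW.
Qed.

Lemma slope_level_attained b : 0 <= b -> M b <= phi -> phi <= M 0 ->
  exists2 z, 0 <= z <= b & M z = phi.
Proof.
move=> b0 Mb M0.
have Mc : continuous M.
  apply: (@lipschitz_cts _ _ a^-1); first by rewrite invr_gt0.
  move=> x y; wlog xy : x y / x <= y.
    by move=> H; have [/H//|/ltW/H] := leP x y; rewrite distrC [`|y - x|]distrC.
  have /andP[M1 M2] := M_lipschitz _ _ xy.
  by rewrite ger0_norm // distrC ger0_norm ?subr_ge0 // mulrC.
have [|z zb Mz] := @IVT _ M 0 b phi b0 (continuous_subspaceT Mc).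
  by rewrite ge_min le_max Mb M0 orbT.
by exists z => //; move: zb; rewrite in_itv.
Qed.

End FirstOrder.

(** * Pointwise study of the slope at a fixed fading value *)

Section Slope.
Context {R : realType} (lambda mu phi sigma : R).
Hypotheses (lambda_gt0 : 0 < lambda) (mu_gt0 : 0 < mu) (phi_gt0 : 0 < phi)
  (sigma_gt0 : 0 < sigma).

Local Notation a := (lambda * phi / mu).
Local Notation s := (sigma ^+ 2).
Local Notation q := (opt_power lambda mu phi sigma).
Local Notation C := (Cfun lambda mu phi sigma).
Local Notation payoff := (payoff lambda mu phi sigma).

(** For [z > 0] this is the [z]-derivative of the payoff up to the factor [mu / phi]. For [z <= 0]
    it stays at its value at 0, so negative [z] are treated separately in [payoff_neg]. *)
Definition slope (z h : R) : R := a * h ^+ 2 / (s + q z h * h ^+ 2).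

Lemma level_gt0 : 0 < a.
Proof. by rewrite divr_gt0 ?mulr_gt0. Qed.

Lemma noise_gt0 : 0 < s.
Proof. exact: exprn_gt0. Qed.

Lemma kappaE : s * kappa lambda mu phi sigma = a.
Proof. by rewrite /kappa; field; rewrite !gt_eqF. Qed.

Lemma opt_power_ge0 z h : 0 <= q z h.
Proof. by rewrite /opt_power /posp !le_max lexx !orbT. Qed.

Lemma opt_power_ge z h : z <= q z h.
Proof. by rewrite /opt_power /posp !le_max lexx !orbT. Qed.

Lemma opt_power_nondec y z h : y <= z -> q y h <= q z h <= q y h + (z - y).
Proof.
rewrite /opt_power /posp; move: (waterfill _ _ _ _ _) => w yz.
by case: (leP y 0) => ?; case: (leP z 0) => ?; rewrite !maxEle;
  do 2?[case: ifPn; rewrite -?ltNge => ?]; lra.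
Qed.

Lemma opt_power_neg z h : z <= 0 -> q z h = q 0 h.
Proof. by move=> z0; rewrite /opt_power /posp (max_idPr z0) maxxx. Qed.

(** After division by [h ^+ 2], the power is at least the water-filling level. This is what bounds
    [slope] by 1. *)
Lemma level_le_denom z h : a * h ^+ 2 <= s + q z h * h ^+ 2.
Proof.
have [->|h0] := eqVneq h 0.
  by rewrite expr0n /= !mulr0 addr0 ltW ?noise_gt0.
have h2 : 0 < h ^+ 2 by rewrite exprn_even_gt0.
rewrite -lerBlDl -ler_pdivrMr //.
have -> : (a * h ^+ 2 - s) / h ^+ 2 = a - s / h ^+ 2.
  by field; rewrite h0 gt_eqF.
by rewrite /opt_power /waterfill (negbTE h0) /posp !le_max lexx.
Qed.

Lemma denom_gt0 z h : 0 < s + q z h * h ^+ 2.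
Proof.
by rewrite ltr_wpDr ?noise_gt0 // mulr_ge0 ?opt_power_ge0 ?sqr_ge0.
Qed.

Lemma slope_ge0 z h : 0 <= slope z h.
Proof.
apply: divr_ge0; last exact/ltW/denom_gt0.
by rewrite mulr_ge0 ?sqr_ge0 // ltW ?level_gt0.
Qed.

Lemma slope_le1 z h : slope z h <= 1.
Proof. by rewrite ler_pdivrMr ?denom_gt0 // mul1r level_le_denom. Qed.

(* Complementary slackness: either water-filling is active, and then the
   denominator of [slope] is [a * h ^+ 2], or the allocated power is [z]. *)
Lemma slope_slack z h : 0 <= z -> (1 - slope z h) * (q z h - z) = 0.
Proof.
move=> z0; have [wz|zw] := leP (waterfill lambda mu phi sigma h) z.
  rewrite /opt_power /posp (max_idPl z0) (max_idPr wz) subrr mulr0 //.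
suff -> : slope z h = 1 by rewrite subrr mul0r.
move: zw; rewrite /slope /opt_power /posp (max_idPl z0) => zw.
rewrite (max_idPl (ltW zw)).
move: zw; rewrite /waterfill; case: eqVneq => [_|h0]; first by lra.
rewrite /posp lt_max (le_gtF z0) orbF => zw.
rewrite (max_idPl _); last exact: ltW (le_lt_trans z0 zw).
have -> : s + (a - s / h ^+ 2) * h ^+ 2 = a * h ^+ 2.
  by field; rewrite h0 gt_eqF.
by rewrite divff // mulf_neq0 ?expf_neq0 // gt_eqF ?level_gt0.
Qed.

(** With denominators [Dy] and [Dz], the difference is [a * h ^+ 2 * (Dz - Dy) / (Dy * Dz)]. Both
    denominators are at least [a * h ^+ 2], and the power is 1-Lipschitz in [z]. *)
Lemma slope_lipschitz y z h : y <= z ->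
  0 <= slope y h - slope z h <= (z - y) / a.
Proof.
move=> yz; have /andP[q1 q2] := opt_power_nondec y z h yz.
have [y0 z0] := (denom_gt0 y h, denom_gt0 z h).
have [ya za] := (level_le_denom y h, level_le_denom z h).
have a0 := level_gt0; have g0 := sqr_ge0 h.
rewrite /slope; set A := a in a0 ya za *.
have dD : (s + q z h * h ^+ 2) - (s + q y h * h ^+ 2)
  = h ^+ 2 * (q z h - q y h) by ring.
move: (s + q z h * h ^+ 2) (s + q y h * h ^+ 2) y0 z0 ya za dD
  => Dz Dy y0 z0 ya za dD.
have -> : A * h ^+ 2 / Dy - A * h ^+ 2 / Dz
    = A * h ^+ 2 * (Dz - Dy) / (Dy * Dz) by field; rewrite !gt_eqF.
have A0 : 0 <= A * h ^+ 2 by rewrite mulr_ge0 // ltW.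
have DD : 0 < Dy * Dz by rewrite mulr_gt0.
rewrite dD; apply/andP; split.
  apply: divr_ge0; last exact: ltW.
  by rewrite mulr_ge0 // mulr_ge0 // subr_ge0.
rewrite ler_pdivrMr ?mulr_gt0 //.
have -> : (z - y) / A * (Dy * Dz) = Dy * Dz * (z - y) / A.
  by field; rewrite gt_eqF.
rewrite ler_pdivlMr //.
have -> : A * h ^+ 2 * (h ^+ 2 * (q z h - q y h)) * A =
   (A * h ^+ 2) * (A * h ^+ 2) * (q z h - q y h) by ring.
apply: ler_pM; [exact: mulr_ge0 | by rewrite subr_ge0 | exact: ler_pM
  | by rewrite lerBlDl].
Qed.

(** The denominator is at least [z * h ^+ 2]. The bound later supplies a point where the mean slope
    is at most [phi]. *)
Lemma slope_le_inv z h : 0 < z -> slope z h <= a / z.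
Proof.
move=> z0; rewrite ler_pdivrMr ?denom_gt0 //.
have -> : a / z * (s + q z h * h ^+ 2) = a * (s + q z h * h ^+ 2) / z.
  by field; rewrite !gt_eqF.
rewrite ler_pdivlMr // -(mulrA a) ler_pM2l ?level_gt0 // mulrC.
apply: ler_wpDl; first exact/ltW/noise_gt0.
by rewrite ler_wpM2r ?sqr_ge0 ?opt_power_ge.
Qed.

Lemma payoff_opt z h :
  payoff z h = lambda * (ln (s + q z h * h ^+ 2) - ln s)
               - mu / phi * (q z h - z).
Proof.
have s0 := noise_gt0.
rewrite /payoff /rate /posp (max_idPl _) ?subr_ge0 ?opt_power_ge //.
rewrite -ln_div ?posrE ?denom_gt0 //; congr (_ * ln _ - _).
by field; rewrite gt_eqF.
Qed.

(** The tangent bounds of [ln] at both ends give the power increment times a slope; complementary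
    slackness trades the power increment for [z - y]. *)
Lemma payoff_increment y z h : 0 <= y -> y <= z ->
  mu / phi * ((z - y) * slope z h) <= payoff z h - payoff y h <=
  mu / phi * ((z - y) * slope y h).
Proof.
move=> y0 yz; have z0 := le_trans y0 yz.
have [Dy Dz] := (denom_gt0 y h, denom_gt0 z h).
have k0 : 0 < mu / phi by rewrite divr_gt0.
have /andP[U L] : a * ((q z h - q y h) * h ^+ 2) / (s + q z h * h ^+ 2) <=
   a * (ln (s + q z h * h ^+ 2) - ln (s + q y h * h ^+ 2)) <=
   a * ((q z h - q y h) * h ^+ 2) / (s + q y h * h ^+ 2).
  rewrite -!(mulrA a) !ler_pM2l ?level_gt0 //.
  have := ln_diff_le _ _ _ Dy Dz; have := ln_diff_le _ _ _ Dz Dy.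
  have -> : s + q y h * h ^+ 2 - (s + q z h * h ^+ 2) =
    - ((q z h - q y h) * h ^+ 2) by ring.
  have -> : s + q z h * h ^+ 2 - (s + q y h * h ^+ 2) =
    (q z h - q y h) * h ^+ 2 by ring.
  by rewrite mulNr; lra.
have -> : payoff z h - payoff y h = mu / phi *
  (a * (ln (s + q z h * h ^+ 2) - ln (s + q y h * h ^+ 2))
   - (q z h - q y h) + (z - y)).
  by rewrite !payoff_opt; field; rewrite !gt_eqF.
rewrite !(ler_pM2l k0).
have Ey : a * ((q z h - q y h) * h ^+ 2) / (s + q y h * h ^+ 2) =
  (q z h - q y h) * slope y h by rewrite /slope; ring.
have Ez : a * ((q z h - q y h) * h ^+ 2) / (s + q z h * h ^+ 2) =
  (q z h - q y h) * slope z h by rewrite /slope; ring.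
rewrite Ey in L; rewrite Ez in U.
(* The gap to either bound is [1 - m] times the difference of the slacks [q z h - z] and
   [q y h - y], where [m] is the slope in that bound. The slack at the point of [m] contributes
   zero, and the other contributes with the right sign. *)
have sy := slope_slack y h y0; have sz := slope_slack z h z0.
have ty : 0 <= (1 - slope y h) * (q z h - z).
  by rewrite mulr_ge0 // subr_ge0 ?slope_le1 ?opt_power_ge.
have tz : 0 <= (1 - slope z h) * (q y h - y).
  by rewrite mulr_ge0 // subr_ge0 ?slope_le1 ?opt_power_ge.
apply/andP; split.
- apply: le_trans (lerD (lerD U (lexx (- (q z h - q y h)))) (lexx (z - y))).
  rewrite -subr_ge0; move: tz sz; set m := slope z h.
  by rewrite !mulrBl !mulrBr; lra.
- apply: (le_trans (lerD (lerD L (lexx (- (q z h - q y h)))) (lexx (z - y)))).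
  rewrite -subr_ge0; move: ty sy; set m := slope y h.
  by rewrite !mulrBl !mulrBr; lra.
Qed.

Lemma payoff_neg z h : z <= 0 -> payoff z h = payoff 0 h + mu / phi * z.
Proof. by move=> z0; rewrite !payoff_opt opt_power_neg //; ring. Qed.

Lemma CfunE z h : C z h = a * h ^+ 2 / (s + z * h ^+ 2).
Proof. by rewrite /Cfun kappaE. Qed.

(** Since [q z h >= z], the slope is at most [C z h], and it is at most 1; slackness forces equality
    with one of the two. *)
Lemma slopeE z h : 0 <= z -> slope z h = Num.min 1 (C z h).
Proof.
move=> z0; have g0 := sqr_ge0 h.
have D0 : 0 < s + z * h ^+ 2 by rewrite ltr_wpDr ?noise_gt0 // mulr_ge0.
have slopeC : slope z h <= C z h.
  rewrite CfunE /slope ler_wpM2l //; first exact/mulr_ge0/g0/ltW/level_gt0.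
  rewrite lef_pV2 ?posrE ?denom_gt0 // lerD2l ler_wpM2r //.
  exact: opt_power_ge.
have /eqP := slope_slack z h z0.
rewrite mulf_eq0 !subr_eq0 => /orP[/eqP e|/eqP e].
- by rewrite -e in slopeC *; rewrite (min_idPl slopeC).
- have e' : slope z h = C z h by rewrite CfunE /slope e.
  by rewrite -e' (min_idPr _) // slope_le1.
Qed.

(** For [h != 0], equal slopes mean equal powers. Zero slack at [y] would make the power at [z]
    equal to [y < z], so slackness at [y] leaves only slope 1. *)
Lemma slope_const_eq1 y z h : 0 <= y -> y < z -> h != 0 ->
  slope y h = slope z h -> slope z h = 1.
Proof.
move=> y0 yz h0 e; have z0 := le_trans y0 (ltW yz).
have g0 : 0 < h ^+ 2 by rewrite exprn_even_gt0.
have qe : q y h = q z h.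
  move: e; rewrite /slope => /mulfI e.
  have /e/invr_inj/addrI/mulIf : a * h ^+ 2 != 0.
    by rewrite gt_eqF // (mulr_gt0 level_gt0).
  by apply; rewrite gt_eqF.
have /eqP := slope_slack y h y0; rewrite e qe mulf_eq0 !subr_eq0.
case/orP => [/eqP <- //|/eqP qy].
by have := opt_power_ge z h; rewrite qy leNgt yz.
Qed.

(** Clearing the denominator, [C z h <= 1] reads [(a - z) * h ^+ 2 <= s], that is [h <= Hbar z]; at
    [z = a] it always holds, which matches the value [+oo]. *)
Lemma calH_Cfun z h : 0 <= z <= a -> 0 <= h ->
  (h \in calH lambda mu phi sigma z) = (C z h <= 1).
Proof.
move=> /andP[z0 za] h0.
have s0 := noise_gt0.
have D0 : 0 < s + z * h ^+ 2 by rewrite ltr_wpDr // mulr_ge0 // sqr_ge0.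
rewrite CfunE ler_pdivrMr // mul1r -lerBlDr -mulrBl.
apply/idP/idP; rewrite inE /calH /= /Hbar kappaE.
- case: eqVneq => [-> [] _ _|ne [_]].
    by rewrite subrr mul0r ltW.
  have az : 0 < a - z by rewrite subr_gt0 lt_neqAle ne.
  rewrite lee_fin -(ler_sqr h0) ?nnegrE ?sqrtr_ge0 //.
  rewrite sqr_sqrtr; last by rewrite divr_ge0 ?ltW.
  by rewrite ler_pdivlMr // mulrC.
- move=> H; split=> //.
  case: eqVneq => [_|ne]; first by rewrite leey.
  have az : 0 < a - z by rewrite subr_gt0 lt_neqAle ne.
  rewrite lee_fin -(ler_sqr h0) ?nnegrE ?sqrtr_ge0 //.
  rewrite sqr_sqrtr; last by rewrite divr_ge0 ?ltW.
  by rewrite ler_pdivlMr // mulrC.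
Qed.

Lemma continuous_Cfun z : 0 <= z -> continuous (C z).
Proof.
move=> z0 h.
have D0 : s + z * h ^+ 2 != 0.
  by rewrite gt_eqF // ltr_wpDr ?noise_gt0 // mulr_ge0 // sqr_ge0.
have c2 : (fun x : R => x ^+ 2) x @[x --> h] --> h ^+ 2 by exact: exprn_continuous.
apply: cvgM; first by apply: cvgM => //; exact: cvg_cst.
apply: cvgV => //; apply: cvgD; first exact: cvg_cst.
by apply: cvgM => //; exact: cvg_cst.
Qed.

Lemma measurable_slope z : measurable_fun setT (slope z).
Proof.
(* The power depends on [z] only through its positive part, so [Num.max z 0] brings any [z] into the
   range of [slopeE], where continuity of [C] applies. *)
have -> : slope z = (fun h => Num.min 1 (C (Num.max z 0) h)).
  apply/funext => h; rewrite -slopeE ?le_max ?lexx ?orbT //.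
  rewrite /slope; congr (_ / (_ + _ * _)).
  by rewrite /opt_power /posp -[Num.max (Num.max z 0) 0]maxA maxxx.
apply: measurable_minr; first exact: measurable_cst.
apply: continuous_measurable_fun; apply: continuous_Cfun.
by rewrite le_max lexx orbT.
Qed.

(** * Means of the slope and of the payoff under the law of the fading *)

Context {d : measure_display} {T : measurableType d} {P : probability T R}.
Variable h : {RV P >-> R}.
Hypotheses (phi_le1 : phi <= 1) (h_ge0 : {ae P, forall w, 0 <= h w})
  (payoff_integrable : forall z,
     P.-integrable setT (fun w => (payoff z (h w))%:E)).

Let M z := Rintegral P setT (fun w => slope z (h w)).
Let J z := Rintegral P setT (fun w => payoff z (h w)).

Lemma expectation_Rintegral (X : T -> R) :
  P.-integrable setT (fun w => (X w)%:E) ->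
  'E_P[X]%E = (Rintegral P setT X)%:E.
Proof.
by move=> iX; rewrite expectation.unlock fineK // integrable_fin_num.
Qed.

Lemma Rintegral_probability_cst (c : R) :
  Rintegral P setT (fun=> c) = c.
Proof.
rewrite Rintegral_cst //; have /(congr1 fine) /= -> := probability_setT P.
exact: mulr1.
Qed.

Lemma ae_eq_expectation (X Y : T -> R) :
  measurable_fun setT X -> measurable_fun setT Y ->
  {ae P, forall w, X w = Y w} -> 'E_P[X]%E = 'E_P[Y]%E.
Proof.
move=> mX mY XY; rewrite expectation.unlock; apply: ae_eq_integral => //.
- exact/measurable_EFinP.
- exact/measurable_EFinP.
- by apply: filterS XY => w + _; rewrite /= => ->.
Qed.

Lemma measurable_slope_RV z : measurable_fun setT (fun w => slope z (h w)).
Proof. exact: measurableT_comp (measurable_slope z) _. Qed.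

Lemma slope_integrable z : P.-integrable setT (fun w => (slope z (h w))%:E).
Proof.
apply: (@le_integrable _ _ _ _ _ measurableT _ (cst 1%:E)).
- exact/measurable_EFinP/measurable_slope_RV.
- move=> w _; rewrite /= normr1 lee_fin ger0_norm ?slope_ge0 //.
  exact: slope_le1.
- exact: finite_measure_integrable_cst.
Qed.

Lemma expectation_slope z : 'E_P[fun w => slope z (h w)]%E = (M z)%:E.
Proof. exact/expectation_Rintegral/slope_integrable. Qed.

Lemma integrable_scaled_slope c z :
  P.-integrable setT (fun w => (c * slope z (h w))%:E).
Proof.
have := integrableZl measurableT c (slope_integrable z).
by apply: eq_integrable => // w _; rewrite EFinM.
Qed.

Lemma mean_increment y z : 0 <= y -> y <= z ->
  mu / phi * ((z - y) * M z) <= J z - J y <= mu / phi * ((z - y) * M y).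
Proof.
move=> y0 yz.
rewrite /J -(RintegralB _ (payoff_integrable z) (payoff_integrable y)) //.
have iJ : P.-integrable setT
    (EFin \o (fun w => payoff z (h w) - payoff y (h w))).
  exact: integrableB (payoff_integrable z) (payoff_integrable y).
rewrite !mulrA -!RintegralZl //; try exact: slope_integrable.
apply/andP; split; apply: le_Rintegral => //;
  try exact: integrable_scaled_slope.
- by move=> w _; rewrite -mulrA; have /andP[] := payoff_increment _ _ (h w) y0 yz.
- by move=> w _; rewrite -mulrA; have /andP[] := payoff_increment _ _ (h w) y0 yz.
Qed.

Lemma mean_payoff_neg z : z <= 0 -> J z = J 0 + mu / phi * z.
Proof.
move=> z0; rewrite /J; under eq_Rintegral do rewrite payoff_neg //.
rewrite (RintegralD _ (payoff_integrable 0)) //; last exact: finite_measure_integrable_cst.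
by rewrite Rintegral_probability_cst.
Qed.

Lemma mean_slope_lipschitz y z : y <= z -> 0 <= M y - M z <= (z - y) / a.
Proof.
move=> yz; rewrite /M -RintegralB //; try exact: slope_integrable.
have iD : P.-integrable setT (EFin \o (fun w => slope y (h w) - slope z (h w))).
  exact: integrableB (slope_integrable y) (slope_integrable z).
apply/andP; split.
- by apply: Rintegral_ge0 => w _; have /andP[] := slope_lipschitz _ _ (h w) yz.
- have -> : (z - y) / a = Rintegral P setT (cst ((z - y) / a)).
    by rewrite Rintegral_probability_cst.
  apply: le_Rintegral => //; first exact: finite_measure_integrable_cst.
  by move=> w _; have /andP[] := slope_lipschitz _ _ (h w) yz.
Qed.

Lemma mean_slope_le_inv z : 0 < z -> M z <= a / z.
Proof.
move=> z0; have -> : a / z = Rintegral P setT (cst (a / z)).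
  by rewrite Rintegral_probability_cst.
apply: le_Rintegral => //; first exact: slope_integrable.
- exact: finite_measure_integrable_cst.
- by move=> w _; exact: slope_le_inv.
Qed.

(** Equal means force the ordered slopes to agree almost surely, so the slope is 1 where [h > 0]; it
    is 0 where [h = 0]. Almost surely it is thus the indicator of [h > 0]. *)
Lemma mean_slope_const y z : 0 <= y -> y < z -> M y = M z ->
  P [set w | 0 < h w] = (M z)%:E.
Proof.
move=> y0 yz Myz.
have mD : measurable_fun setT (fun w => slope y (h w) - slope z (h w)).
  by apply: measurable_funB; exact: measurable_slope_RV.
have D0 w : 0 <= slope y (h w) - slope z (h w).
  by have /andP[] := slope_lipschitz _ _ (h w) (ltW yz).
have ae0 : {ae P, forall w, slope y (h w) = slope z (h w)}.
  have : (\int[P]_w `|(slope y (h w) - slope z (h w))%:E| = 0)%E.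
    under eq_integral do rewrite /= ger0_norm //.
    rewrite -[LHS]fineK; last first.
      apply: integrable_fin_num => //.
      exact: integrableB (slope_integrable y) (slope_integrable z).
    rewrite -/(Rintegral P setT _) RintegralB //; try exact: slope_integrable.
    by rewrite -/(M y) -/(M z) Myz subrr.
  move/(ae_eq_integral_abs P measurableT (f := EFin \o _)) => H.
  have {}H := H ((measurable_EFinP _ _).2 mD).
  by apply: filterS H => w /(_ I) [] /eqP; rewrite subr_eq0 => /eqP.
have mpos : measurable [set w | 0 < h w].
  have -> : [set w | 0 < h w] = h @^-1` `]0, +oo[.
    by apply/seteqP; split=> w; rewrite /= in_itv /= andbT.
  exact: measurable_funPTI.
rewrite -expectation_slope -expectation_indic //.
apply: ae_eq_expectation; [exact: measurable_indic|exact: measurable_slope_RV|].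
apply: filterS2 ae0 h_ge0 => w e hw; rewrite indicE.
have [h0|h0] := eqVneq (h w) 0.
  by rewrite memNset /= ?h0 ?ltxx // /slope expr0n /= mulr0 mul0r.
rewrite mem_set /=; last by rewrite lt_neqAle eq_sym h0.
by rewrite (slope_const_eq1 _ _ _ y0 yz h0 e).
Qed.

(** * The objective, the thresholds and the stationarity equations in terms of [J] and [M] *)

Lemma objectiveE z :
  objective lambda mu phi sigma h z = (J z - mu * z)%:E.
Proof.
rewrite /objective expectation_Rintegral // -EFinD.
by rewrite -/(J z) mulNr addrC.
Qed.

Lemma optimalP zs : optimal_solution lambda mu phi sigma h zs <->
  forall z, J z - mu * z <= J zs - mu * zs.
Proof.
by split=> H z; have := H z; rewrite !objectiveE lee_fin.
Qed.

Lemma measurable_calH z : 0 <= z <= a ->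
  measurable (calH lambda mu phi sigma z).
Proof.
move=> za; rewrite /calH /Hbar; case: ifP => _.
  have -> : [set x : R | 0 <= x /\ (x%:E <= +oo)%E] = `[0, +oo[%classic.
    by apply/seteqP; split=> x; rewrite /= in_itv /= andbT leey => // -[].
  exact: measurable_itv.
set r := Num.sqrt _.
have -> : [set x : R | 0 <= x /\ (x%:E <= r%:E)%E] = `[0, r]%classic.
  by apply/seteqP; split=> x; rewrite /= in_itv /= lee_fin => /andP.
exact: measurable_itv.
Qed.

Lemma measurable_calH_RV z : 0 <= z <= a ->
  measurable (h @^-1` calH lambda mu phi sigma z).
Proof. by move=> za; apply: measurable_funPTI; exact: measurable_calH. Qed.

Lemma measurable_indic_calH z : 0 <= z <= a ->
  measurable_fun setT (fun w => \1_(calH lambda mu phi sigma z) (h w) : R).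
Proof.
move=> za; apply: measurableT_comp => //; apply: measurable_indic.
exact: measurable_calH.
Qed.

Lemma measurable_Cfun_RV z : 0 <= z -> measurable_fun setT (fun w => C z (h w)).
Proof.
move=> z0; apply: measurableT_comp => //.
by apply: continuous_measurable_fun; exact: continuous_Cfun.
Qed.

(** Where [h >= 0], the slope is [C] on [calH] and 1 off it, so the integrand is [1 - slope]. *)
Lemma threshold_mean_slope z : 0 <= z <= a ->
  'E_P[fun w => ((1 - C z (h w)) * \1_(calH lambda mu phi sigma z) (h w))%R]%E
  = (1 - M z)%:E.
Proof.
move=> za; have z0 : 0 <= z by case/andP: za.
transitivity ('E_P[fun w => (1 - slope z (h w))%R])%E.
  apply: ae_eq_expectation.
  - apply: measurable_funM; last exact: measurable_indic_calH.
    by apply: measurable_funB => //; exact: measurable_Cfun_RV.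
  - by apply: measurable_funB => //; exact: measurable_slope_RV.
  - apply: filterS h_ge0 => w hw.
    rewrite indicE calH_Cfun // slopeE //; case: leP => _.
      by rewrite mulr1.
    by rewrite mulr0 subrr.
have i1 : P.-integrable setT (EFin \o cst (1 : R)).
  exact: finite_measure_integrable_cst.
rewrite expectation_Rintegral; last exact: integrableB i1 (slope_integrable z).
rewrite RintegralB //; last exact: slope_integrable.
by rewrite Rintegral_probability_cst.
Qed.

(** The distribution function counts []-oo, r]] and [calH] only [[0, r]]; the two events agree
    almost surely because [h >= 0] does. *)
Lemma prob_calH z : 0 <= z <= a ->
  P (h @^-1` calH lambda mu phi sigma z) = ext_cdf h (Hbar lambda mu phi sigma z).
Proof.
move=> za; rewrite -expectation_indic; last exact: measurable_calH_RV.
have mI : measurable_fun setT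
    (\1_(h @^-1` calH lambda mu phi sigma z) : T -> R).
  by apply: measurable_indic; exact: measurable_calH_RV.
case E : (Hbar lambda mu phi sigma z) => [r| |].
- rewrite /= /cdf /distribution /pushforward -expectation_indic; last first.
    exact: measurable_funPTI.
  apply: ae_eq_expectation => //.
    by apply: measurable_indic; exact: measurable_funPTI.
  apply: filterS h_ge0 => w hw; rewrite !indicE; congr (_%:R).
  by apply: congr1; apply/idP/idP; rewrite !inE /calH /= E lee_fin in_itv /=;
    [case | split].
- rewrite /= -(expectation_cst P 1); apply: ae_eq_expectation => //.
  apply: filterS h_ge0 => w hw; rewrite indicE mem_set //.
  by rewrite /calH /= E leey.
- by move: E; rewrite /Hbar; case: ifP.
Qed.

Lemma mean_Cfun_calH z : 0 <= z <= a ->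
  ('E_P[fun w => (C z (h w) * \1_(calH lambda mu phi sigma z) (h w))%R]
   + 1 - ext_cdf h (Hbar lambda mu phi sigma z))%E = (M z)%:E.
Proof.
move=> za; have z0 : 0 <= z by case/andP: za.
pose A := h @^-1` calH lambda mu phi sigma z.
have mA : measurable A by exact: measurable_calH_RV.
have iA : P.-integrable setT (EFin \o \1_A) by exact: integrable_indic.
have i1 : P.-integrable setT (EFin \o cst (1 : R)).
  exact: finite_measure_integrable_cst.
have i1S : P.-integrable setT (EFin \o (fun w => 1 - slope z (h w))).
  exact: integrableB i1 (slope_integrable z).
(* The slope is [C] on [A] and 1 off [A], so both sides agree almost surely. The mean of [\1_A] then
   cancels the distribution function. *)
have -> : 'E_P[fun w => (C z (h w) * \1_(calH lambda mu phi sigma z) (h w))%R]%E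
  = 'E_P[fun w => (\1_A w - (1 - slope z (h w)))%R]%E.
  apply: ae_eq_expectation.
  - apply: measurable_funM; last exact: measurable_indic_calH.
    exact: measurable_Cfun_RV.
  - apply: measurable_funB; first exact: measurable_indic.
    by apply: measurable_funB => //; exact: measurable_slope_RV.
  - apply: filterS h_ge0 => w hw.
    have -> : \1_A w = \1_(calH lambda mu phi sigma z) (h w) :> R.
      by rewrite !indicE; congr (_%:R); apply: congr1; apply/idP/idP; rewrite !inE.
    rewrite indicE calH_Cfun // slopeE //; case: leP => _.
      by rewrite mulr1 subKr.
    by rewrite mulr0 !subrr.
rewrite -prob_calH // -/A -expectation_indic // !expectation_Rintegral //; last first.
  exact: integrableB iA i1S.
rewrite RintegralB // RintegralB //; last exact: slope_integrable.
rewrite Rintegral_probability_cst -/(M z) -!EFinD; congr EFin; ring.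
Qed.

(** For [z >= a] the denominator dominates [a * h ^+ 2], so [C z] is at most 1 and the minimum in
    [slopeE] is [C z] everywhere. *)
Lemma mean_Cfun_ge z : a <= z -> 'E_P[fun w => C z (h w)]%E = (M z)%:E.
Proof.
move=> az; rewrite -expectation_slope; congr expectation; apply/funext => w.
have z0 : 0 <= z := le_trans (ltW level_gt0) az.
rewrite slopeE // (min_idPr _) // CfunE.
rewrite ler_pdivrMr ?mul1r; last first.
  by rewrite ltr_wpDr ?noise_gt0 // mulr_ge0 // sqr_ge0.
by apply: ler_wpDl; [exact/ltW/noise_gt0|rewrite ler_wpM2r // sqr_ge0].
Qed.

(** * Existence of an optimum, its location and its equations *)

Lemma inclusion_setE : inclusion_set lambda mu phi sigma h =
  if M 0 <= phi then [set 0]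
  else if M a <= phi then `]0, a]%classic else `]a, +oo[%classic.
Proof.
have a0 := level_gt0.
(* This is the general threshold at [z = 0], since [C 0 h] is [kappa] times [h ^+ 2]. *)
have t0 : threshold0 lambda mu phi sigma h = (1 - M 0)%:E.
  rewrite -threshold_mean_slope ?lexx ?ltW //; congr expectation.
  apply/funext => w; congr ((1 - _) * _).
  by rewrite CfunE mul0r addr0 -kappaE; field; rewrite gt_eqF ?noise_gt0.
have t1 : threshold1 lambda mu phi sigma h = (1 - M a)%:E.
  by rewrite /threshold1 kappaE threshold_mean_slope // lexx ltW.
by rewrite /inclusion_set t0 t1 !lee_fin kappaE !lerD2l !lerN2.
Qed.

Lemma mean_slope_nonincr y z : y <= z -> M z <= M y.
Proof. by move=> /mean_slope_lipschitz/andP[]; rewrite subr_ge0. Qed.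

Lemma optimal_in_inclusion : exists zs : R,
  optimal_solution lambda mu phi sigma h zs /\
  inclusion_set lambda mu phi sigma h zs.
Proof.
have a0 := level_gt0; rewrite inclusion_setE.
have [M0|M0] := leP.
  exists 0; split => //; apply/optimalP.
  exact: (zero_maximizer mu_gt0 phi_gt0 mean_increment mean_payoff_neg).
(* Any [b >= 0] with [M b <= phi] traps a stationary point in []0, b]]; 0 itself is excluded by
   [phi < M 0]. *)
have attain b : 0 <= b -> M b <= phi -> exists2 z, 0 < z <= b &
    optimal_solution lambda mu phi sigma h z /\ M z = phi.
  move=> b0 Mb.
  have [z /andP[z0 zb] Mz] :=
    slope_level_attained a0 mean_slope_lipschitz _ b0 Mb (ltW M0).
  exists z.
    rewrite zb andbT lt_neqAle z0 andbT; apply/eqP => z0'.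
    by move: M0; rewrite z0' Mz ltxx.
  split=> //; apply/optimalP.
  exact: (stationary_maximizer mu_gt0 phi_gt0 mean_increment mean_payoff_neg).
have [Ma|Ma] := leP.
  have [z za [oz _]] := attain a (ltW a0) Ma.
  by exists z; split; rewrite //= in_itv.
(* At [a / phi] the bound [M z <= a / z] equals [phi]. *)
have b0 : 0 < a / phi by rewrite divr_gt0.
have [|z _ [oz Mz]] := attain (a / phi) (ltW b0).
  apply: le_trans (mean_slope_le_inv _ b0) _.
  suff -> : a / (a / phi) = phi by [].
  by field; rewrite !gt_eqF.
exists z; split; rewrite //= in_itv /= andbT ltNge; apply/negP => za.
by have := mean_slope_nonincr _ _ za; rewrite Mz leNgt Ma.
Qed.

Lemma optimal_mean_slope zs : optimal_solution lambda mu phi sigma h zs ->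
  0 < zs -> M zs = phi.
Proof.
move=> /optimalP opt zs0.
exact: (positive_maximizer mu_gt0 phi_gt0 level_gt0 mean_increment
  mean_slope_lipschitz).
Qed.

(** For [phi = 1] every negative [z] ties with 0, and for [P (h > 0) = phi] the mean slope can equal
    [phi] on an interval starting at 0, so that positive points tie with 0. Excluding both cases
    leaves an optimum whose position the thresholds decide. *)
Lemma all_optimal_in_inclusion : phi < 1 -> P [set w | 0 < h w] <> phi%:E ->
  forall zs, optimal_solution lambda mu phi sigma h zs ->
  inclusion_set lambda mu phi sigma h zs.
Proof.
move=> phi1 Ph zs opt; have /optimalP opt' := opt.
have a0 := level_gt0.
have zs0 : 0 <= zs by exact: (maximizer_ge0 mu_gt0 phi_gt0 mean_payoff_neg).
(* Equality would give [M y = M zs = phi] at two distinct points, and [mean_slope_const] would yield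
   the excluded value of [P (h > 0)]. *)
have strict y : 0 <= y -> y < zs -> phi < M y.
  move=> y0 yz; have Mz := optimal_mean_slope _ opt (le_lt_trans y0 yz).
  rewrite -Mz lt_neqAle mean_slope_nonincr ?(ltW yz) // andbT.
  by apply/eqP => e; apply: Ph; rewrite (mean_slope_const _ _ y0 yz) // Mz.
have Mzs : M zs <= phi.
  exact: (right_maximizer_le mu_gt0 phi_gt0 a0 mean_increment
    mean_slope_lipschitz).
rewrite inclusion_setE; have [M0|M0] := leP.
  apply/eqP; rewrite eq_le zs0 andbT leNgt; apply/negP => zpos.
  by have := strict 0 (lexx _) zpos; rewrite ltNge M0.
have [Ma|Ma] := leP.
  rewrite /= in_itv /= lt_neqAle zs0 andbT; apply/andP; split.
    by apply/eqP => e; move: M0; rewrite e ltNge Mzs.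
  rewrite leNgt; apply/negP => za.
  by have := strict a (ltW a0) za; rewrite ltNge Ma.
rewrite /= in_itv /= andbT ltNge; apply/negP => za.
by have := mean_slope_nonincr _ _ za; rewrite leNgt (le_lt_trans Mzs Ma).
Qed.

Lemma optimal_first_order zs : optimal_solution lambda mu phi sigma h zs ->
  (0 < zs <= a ->
     ('E_P[fun w => (C zs (h w) * \1_(calH lambda mu phi sigma zs) (h w))%R]
      + 1 - ext_cdf h (Hbar lambda mu phi sigma zs) = phi%:E)%E) /\
  (a <= zs -> 'E_P[fun w => C zs (h w)]%E = phi%:E).
Proof.
move=> opt; split=> [/andP[zs0 za]|az].
- by rewrite mean_Cfun_calH ?(ltW zs0) // (optimal_mean_slope _ opt zs0).
- by rewrite mean_Cfun_ge // (optimal_mean_slope _ opt (lt_le_trans level_gt0 az)).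
Qed.

End Slope.
(** Optimal points need not be unique, hence the separate claims for some optimum and for all
    optima. *)
Theorem theorem2 (R : realType) (d : measure_display) (T : measurableType d)
    (P : probability T R) (NU : nat) (lambda phi sigma : 'I_NU -> R) (mu : R)
    (h : 'I_NU -> {RV P >-> R}) (i : 'I_NU)
    (lambda_gt0 : 0 < lambda i) (mu_gt0 : 0 < mu)
    (phi_gt0 : 0 < phi i) (phi_le1 : phi i <= 1) (sigma_gt0 : 0 < sigma i)
    (h_ge0 : {ae P, forall w, 0 <= h i w})
    (payoff_integrable : forall z : R, P.-integrable setT
       (fun w => (payoff (lambda i) mu (phi i) (sigma i) z (h i w))%:E)) :
  let a := sigma i ^+ 2 * kappa (lambda i) mu (phi i) (sigma i) in
  let C := Cfun (lambda i) mu (phi i) (sigma i) in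
  let Hb := Hbar (lambda i) mu (phi i) (sigma i) in
  let HH := calH (lambda i) mu (phi i) (sigma i) in
  let optimal := optimal_solution (lambda i) mu (phi i) (sigma i) (h i) in
  let incl := inclusion_set (lambda i) mu (phi i) (sigma i) (h i) in
  [/\ exists zs : R, optimal zs /\ incl zs,
      phi i < 1 -> P [set w | 0 < h i w] <> (phi i)%:E ->
        forall zs : R, optimal zs -> incl zs
    & forall zs : R, optimal zs ->
        (0 < zs <= a ->
          ('E_P[fun w => (C zs (h i w) * \1_(HH zs) (h i w))%R]
            + 1 - ext_cdf (h i) (Hb zs) = (phi i)%:E)%E) /\
        (a <= zs -> ('E_P[fun w => C zs (h i w)] = (phi i)%:E)%E)].
Proof.
move=> a C Hb HH optimal incl; split.
- exact: optimal_in_inclusion.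
- exact: all_optimal_in_inclusion.
- by move=> zs; rewrite /a kappaE //; exact: optimal_first_order.
Qed.
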